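(* Let $V=\{1,\dots,n\}$, $k\ge1$, let $f:\mathscr S\to\mathbb R$ be a nonnegative, monotone, $k$-submodular function, let $c_a$ ($a\in V$) be positive integer costs and $B\in\mathbb R$ a budget. Consider the problem $\max\{f(S): S\in\mathscr S,\ c(S)\le B\}$, where $c(S)=\sum_{a\in U(S)}c_a$. The algorithm described below returns a feasible solution $S_A$ satisfying $f(S_A)\ge\left(\tfrac12-\tfrac1{2e}\right)f(T)$ for every feasible $T\in\mathscr S$ (i.e., it has approximation ratio $\tfrac12-\tfrac1{2e}$), and it evaluates $f$ $O(n^5k^4)$ times. Algorithm: (1) Let $S_A$ be a solution of maximum $f$-value among all $S\in\mathscr S$ with $|S|\le2$ and $c(S)\le B$. (2) For every $I\in\mathscr S$ with $|I|=3$ and $c(I)\le B$: set $S^0=I$, $V^0=V\setminus U(I)$; for $t=1,\dots,n$ (while $V^{t-1}\neq\emptyset$): let $(a_t,i_t)$ attain $\theta_t=\max_{a\in V^{t-1},\,i\in[k]}\Delta_{a,i}(S^{t-1})/c_a$; if $c(S^{t-1})+c_{a_t}\le B$ set $S^t=S^{t-1}\cup\{(a_t,i_t)\}$, otherwise $S^t=S^{t-1}$; set $V^t=V^{t-1}\setminus\{a_t\}$. At the end, if the final set $S^{\mathrm{fin}}$ satisfies $f(S^{\mathrm{fin}})>f(S_A)$, replace $S_A$ by $S^{\mathrm{fin}}$. (3) Return $S_A$.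
   Context: $[k]=\{1,\dots,k\}$. $\mathscr S$ is the family of sets $S\subseteq V\times[k]$ in which each item $a\in V$ appears in at most one pair; $U(S)=\{a\in V:\exists i,\ (a,i)\in S\}$ and $|S|=|U(S)|$. Such $S$ is identified with the $k$-tuple of pairwise disjoint subsets $(X_1,\dots,X_k)$, $X_i=\{a:(a,i)\in S\}$. For tuples $\mathbf x,\mathbf y$, $\mathbf x\sqcup\mathbf y$ has $i$-th component $(X_i\cup Y_i)\setminus\bigcup_{j\ne i}(X_j\cup Y_j)$ and $\mathbf x\sqcap\mathbf y$ has $i$-th component $X_i\cap Y_i$; $f$ is $k$-submodular if $f(\mathbf x)+f(\mathbf y)\ge f(\mathbf x\sqcup\mathbf y)+f(\mathbf x\sqcap\mathbf y)$ for all $\mathbf x,\mathbf y$, and monotone if $f(S)\le f(S')$ whenever $S\subseteq S'$. $\Delta_{a,i}(S)=f(S\cup\{(a,i)\})-f(S)$. *)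

(* Defs.v *)
From HB Require Import structures.
From mathcomp Require Import all_boot all_order all_algebra.
From mathcomp Require Import reals.

Set Implicit Arguments.
Unset Strict Implicit.
Unset Printing Implicit Defensive.

Import Order.TTheory GRing.Theory Num.Theory.
Local Open Scope ring_scope.

(** * Partial labellings: the family of sets S of pairs (item, label) in which
    each item occurs at most once *)

Definition is_sol (n k : nat) (S : {set 'I_n * 'I_k}) : bool :=
  [forall a : 'I_n, (#|[set p in S | p.1 == a]| <= 1)%N].

Record sol (n k : nat) : Type :=
  Sol { sol_set :> {set 'I_n * 'I_k}; solP : is_sol sol_set }.

HB.instance Definition _ (n k : nat) := [isSub for @sol_set n k].
HB.instance Definition _ (n k : nat) := [Finite of sol n k by <:].

Definition items (n k : nat) (S : {set 'I_n * 'I_k}) : {set 'I_n} :=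
  [set a | [exists i : 'I_k, (a, i) \in S]].

Definition part (n k : nat) (S : {set 'I_n * 'I_k}) (i : 'I_k) : {set 'I_n} :=
  [set a | (a, i) \in S].

Lemma is_solP (n k : nat) (S : {set 'I_n * 'I_k}) :
  reflect (forall a i j, (a, i) \in S -> (a, j) \in S -> i = j) (is_sol S).
Proof.
apply: (iffP forallP) => [solS a i j aiS ajS | uniqS a].
  have /card_le1P/(_ (a, i)) := solS a.
  rewrite inE aiS eqxx => /(_ isT) /(_ (a, j)).
  by rewrite inE ajS !inE eqxx => /esym/eqP[].
apply/card_le1_eqP => -[b i] [d j]; rewrite !inE /=.
by move=> /andP[biS /eqP eb] /andP[djS /eqP ed]; subst; rewrite (uniqS a i j).
Qed.

Definition sqcup_set (n k : nat) (S T : {set 'I_n * 'I_k}) :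
    {set 'I_n * 'I_k} :=
  [set p | p.1 \in (part S p.2 :|: part T p.2)
                   :\: \bigcup_(j | j != p.2) (part S j :|: part T j)].

Definition sqcap_set (n k : nat) (S T : {set 'I_n * 'I_k}) :
    {set 'I_n * 'I_k} :=
  [set p | p.1 \in part S p.2 :&: part T p.2].

Lemma sqcup_subproof (n k : nat) (S T : sol n k) : is_sol (sqcup_set S T).
Proof.
apply/is_solP => a i j; rewrite !in_set /= => /andP[ni _] /andP[_ aj].
apply/eqP; apply: contraNT ni => ij.
by apply/bigcupP; exists j; rewrite 1?eq_sym // !inE.
Qed.

Lemma sqcap_subproof (n k : nat) (S T : sol n k) : is_sol (sqcap_set S T).
Proof.
apply/is_solP => a i j; rewrite !inE /= => /andP[ai _] /andP[aj _].
exact: (is_solP _ (solP S)) ai aj.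
Qed.

Definition sqcup (n k : nat) (S T : sol n k) : sol n k :=
  Sol (sqcup_subproof S T).

Definition sqcap (n k : nat) (S T : sol n k) : sol n k :=
  Sol (sqcap_subproof S T).

(** [add S (a, i)] is S together with (a, i); it is meant for items [a] that do
    not occur in [S] (see [addE]), and defaults to [S] when the union is not a
    partial labelling. *)
Definition add (n k : nat) (S : sol n k) (p : 'I_n * 'I_k) : sol n k :=
  insubd S (p |: sol_set S).

Lemma addE (n k : nat) (S : sol n k) (a : 'I_n) (i : 'I_k) :
  a \notin items S -> sol_set (add S (a, i)) = (a, i) |: sol_set S.
Proof.
rewrite inE negb_exists => /forallP aS.
rewrite /add -[LHS]/(val _) val_insubd ifT //; apply/is_solP => b j l.
rewrite !inE => /orP[/eqP[-> ->]|bj] /orP[/eqP[]|bl] //.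
- by move: (aS l); rewrite bl.
- by move=> e; move: (aS j); rewrite -e bj.
- exact: (is_solP _ (solP S)) bj bl.
Qed.

Definition nonnegative (R : realType) (n k : nat) (f : sol n k -> R) : Prop :=
  forall S, 0 <= f S.

Definition monotone (R : realType) (n k : nat) (f : sol n k -> R) : Prop :=
  forall S S' : sol n k, sol_set S \subset sol_set S' -> f S <= f S'.

Definition ksubmodular (R : realType) (n k : nat) (f : sol n k -> R) : Prop :=
  forall S T, f (sqcup S T) + f (sqcap S T) <= f S + f T.

Definition cost (n k : nat) (c : 'I_n -> nat) (S : sol n k) : nat :=
  (\sum_(a in items S) c a)%N.

Definition feasible (R : realType) (n k : nat) (c : 'I_n -> nat) (B : R)
    (S : sol n k) : bool :=
  (cost c S)%:R <= B.

(** * Nondeterministic computations with a value oracle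

    A program has no access to the objective function except through [Query];
    [Choose P] stands for an arbitrary choice of an element satisfying [P] (how
    ties are broken, in which order a set is enumerated). *)

Inductive prog (R : realType) (n k : nat) (T : Type) : Type :=
| Ret of T
| Query of sol n k & (R -> prog R n k T)
| Choose (X : Type) of pred X & (X -> prog R n k T).

Arguments Ret {R n k T} x.
Arguments Query {R n k T} S cont.
Arguments Choose {R n k T X} P cont.

Fixpoint bind (R : realType) (n k : nat) (T T' : Type) (p : prog R n k T)
    (g : T -> prog R n k T') : prog R n k T' :=
  match p with
  | Ret x => g x
  | Query q cont => Query q (fun r => bind (cont r) g)
  | Choose _ P cont => Choose P (fun y => bind (cont y) g)
  end.

Notation "'let*' x ':=' p 'in' q" := (bind p (fun x => q))
  (at level 200, x name, p at level 100, q at level 200).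

(** [exec f p x m]: some run of [p] with oracle [f] returns [x] after exactly
    [m] evaluations of [f]. *)
Fixpoint exec (R : realType) (n k : nat) (T : Type) (f : sol n k -> R)
    (p : prog R n k T) (x : T) (m : nat) : Prop :=
  match p with
  | Ret y => x = y /\ m = 0%N
  | Query q cont => exists2 m', m = m'.+1 & exec f (cont (f q)) x m'
  | Choose _ P cont => exists2 y, P y & exec f (cont y) x m
  end.

(** [never_stuck f p]: no run of [p] with oracle [f] reaches a [Choose] without
    admissible choice; as programs are well-founded trees, every run then
    returns a value. *)
Fixpoint never_stuck (R : realType) (n k : nat) (T : Type) (f : sol n k -> R)
    (p : prog R n k T) : Prop :=
  match p with
  | Ret _ => True
  | Query q cont => never_stuck f (cont (f q))
  | Choose _ P cont =>
      (exists y, P y) /\ (forall y, P y -> never_stuck f (cont y))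
  end.

(** * The algorithm

    Evaluations are never cached: every occurrence of f in the description of
    the algorithm is charged each time it is reached. *)

Definition eval (R : realType) (n k : nat) (S : sol n k) : prog R n k R :=
  Query S Ret.

Fixpoint tabulate (R : realType) (n k : nat) (X : Type) (g : X -> prog R n k R)
    (s : seq X) : prog R n k (seq (X * R)) :=
  if s is x :: s' then
    let* v := g x in
    let* tbl := tabulate g s' in
    Ret ((x, v) :: tbl)
  else Ret [::].

(** Computes the values of [g] on all of [s], then returns an arbitrary
    maximizer. *)
Definition argmax (R : realType) (n k : nat) (X : eqType)
    (g : X -> prog R n k R) (s : seq X) : prog R n k X :=
  let* tbl := tabulate g s in
  Choose [pred p : X * R | (p \in tbl) && all (fun q => q.2 <= p.2) tbl]
       (fun p => Ret p.1).

Definition marginal (R : realType) (n k : nat) (S : sol n k)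
    (p : 'I_n * 'I_k) : prog R n k R :=
  let* v := eval R (add S p) in
  let* w := eval R S in
  Ret (v - w).

Definition density (R : realType) (n k : nat) (c : 'I_n -> nat) (S : sol n k)
    (p : 'I_n * 'I_k) : prog R n k R :=
  let* d := marginal R S p in
  Ret (d / (c p.1)%:R).

(** At most [t] further rounds from the current solution [S] and the set [W] of
    items not considered yet. *)
Fixpoint greedy (R : realType) (n k : nat) (c : 'I_n -> nat) (B : R)
    (t : nat) (S : sol n k) (W : {set 'I_n}) : prog R n k (sol n k) :=
  if t is t'.+1 then
    if W == set0 then Ret S else
    let* p := argmax (density R c S)
                (enum [set p : 'I_n * 'I_k | p.1 \in W]) in
    greedy c B t'
      (if (cost c S + c p.1)%N%:R <= B then add S p else S) (W :\ p.1)
  else Ret S.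

Fixpoint improve (R : realType) (n k : nat) (c : 'I_n -> nat) (B : R)
    (s : seq (sol n k)) (SA : sol n k) : prog R n k (sol n k) :=
  if s is J :: s' then
    let* Sfin := greedy c B n J (~: items J) in
    let* v := eval R Sfin in
    let* w := eval R SA in
    improve c B s' (if w < v then Sfin else SA)
  else Ret SA.

Definition algorithm (R : realType) (n k : nat) (c : 'I_n -> nat) (B : R) :
    prog R n k (sol n k) :=
  let* SA := argmax (@eval R n k)
    (enum [set S : sol n k | (#|items S| <= 2)%N && feasible c B S]) in
  Choose (perm_eq (enum [set J : sol n k | (#|items J| == 3)%N && feasible c B J]))
    (fun s => improve c B s SA).

Arguments algorithm {R} n k c B.

(* Main.v *)
Require Import Defs.
From mathcomp Require Import all_boot all_order all_algebra.
From mathcomp Require Import reals sequences exp.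
From mathcomp Require Import ring lra zify.

(** Let [T] be feasible with at least three pairs, and let [I] be a triple of
    pairs of [T] containing one of maximal value, so that removing any pair
    from [T] loses at most [f I].  Run the greedy phase from [I], and let
    [I <= T0 <= T].  Relabelling in [T0] the items that the current solution [S]
    has picked costs at most [f S - f I], because greedy takes the best label;
    the remaining pairs of [T0] have density at most the greedy density
    [theta].  Hence, as long as no item of [T0] has been rejected,
    [f T0 - f I <= 2 (f S - f I) + (c T0 - c I) theta],
    which makes [(f T0 - f I) / 2 - (f S - f I)] decay exponentially in
    [(c S - c I) / (c T0 - c I)].
    If no item of [T] is ever rejected, then [f T - f I <= 2 (f S - f I)] at the
    end.  Otherwise take for [T0] the solution [T] without the first rejected
    pair: at that moment [c S > c T0], so [S] has collected a fraction
    [(1 - 1/e) / 2] of [f T0 - f I >= f T - 2 f I], and [f I] makes up for the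
    missing [2 f I]. *)

Set Implicit Arguments.
Unset Strict Implicit.
Unset Printing Implicit Defensive.

Import Order.TTheory GRing.Theory Num.Theory.
(* [solP] and [add] are shadowed by the imports above. *)
Import Defs.
Local Open Scope ring_scope.

(** * Partial labellings *)

Lemma leq_sum_subset (A : finType) (X Y : {set A}) (F : A -> nat) :
  X \subset Y -> (\sum_(x in X) F x <= \sum_(x in Y) F x)%N.
Proof. by move=> sXY; rewrite (big_setID X (A := Y)) /= (setIidPr sXY) leq_addr. Qed.

Lemma cards3 (A : finType) (x y z : A) : x != y -> y != z -> z != x ->
  #|[set x; y; z]| = 3.
Proof.
move=> xy yz zx; rewrite setUC cardsU1 cards2 xy !inE negb_or zx.
by rewrite eq_sym yz.
Qed.

Section Labellings.
Variables n k : nat.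
Implicit Types (S T : sol n k) (X Y : {set 'I_n * 'I_k}) (p q : 'I_n * 'I_k).

Lemma sol_fst_inj S : {in sol_set S &, injective fst}.
Proof.
by move=> [a i] [b j] aiS /[swap] /= <- ajS; rewrite (is_solP _ (solP S) a i j).
Qed.

Lemma items_imset X : items X = [set p.1 | p in X].
Proof.
apply/setP => a; rewrite inE; apply/existsP/imsetP => [[i aiX]|[[b i] biX ->]].
  by exists (a, i).
by exists i.
Qed.

Lemma mem_items X p : p \in X -> p.1 \in items X.
Proof. by rewrite items_imset; apply: imset_f. Qed.

Lemma items_subset X Y : X \subset Y -> items X \subset items Y.
Proof. by rewrite !items_imset; apply: imsetS. Qed.

Lemma card_items S : #|items S| = #|sol_set S|.
Proof. by rewrite items_imset card_in_imset //; apply: sol_fst_inj. Qed.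

Lemma cost_pairs (c : 'I_n -> nat) S :
  cost c S = (\sum_(p in sol_set S) c p.1)%N.
Proof. by rewrite /cost items_imset big_imset //=; apply: sol_fst_inj. Qed.

Lemma cost_subset (c : 'I_n -> nat) S T :
  sol_set S \subset sol_set T -> (cost c S <= cost c T)%N.
Proof. by move=> sST; rewrite leq_sum_subset ?items_subset. Qed.

Lemma is_sol_subset X Y : X \subset Y -> is_sol Y -> is_sol X.
Proof.
move=> /subsetP sXY /is_solP uY; apply/is_solP => a i j /sXY aiY /sXY.
exact: uY.
Qed.

(** Common form for all sublabellings used below: [set0] gives the empty one, [[set p]] a single
    pair, and [~: [set q]] drops [q]. *)
Definition restr S X : sol n k :=
  Sol (is_sol_subset (subsetIl (sol_set S) X) (solP S)).

Lemma subset_add S p : sol_set S \subset sol_set (add S p).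
Proof.
by rewrite /add -[sol_set (insubd _ _)]/(val _) val_insubd; case: ifP => // _;
  rewrite subsetUr.
Qed.

Lemma add_set S p : p.1 \notin items S -> sol_set (add S p) = p |: sol_set S.
Proof. by case: p => a i; apply: addE. Qed.

(** Only an inclusion, since [add] falls back to [S] when the item of [p] already carries another
    label. *)
Lemma items_add S p : items (add S p) \subset p.1 |: items S.
Proof.
rewrite /add -[sol_set (insubd _ _)]/(val _) val_insubd; case: ifP => _.
  by rewrite !items_imset imsetU1.
exact: subsetUr.
Qed.

Lemma cost_add_le (c : 'I_n -> nat) S p :
  (cost c (add S p) <= cost c S + c p.1)%N.
Proof.
rewrite /cost addnC; have := items_add S p.
have [pS|pS] := boolP (p.1 \in items S).
  rewrite (setUidPr _) ?sub1set // => sub.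
  by rewrite (leq_trans _ (leq_addl _ _)) // leq_sum_subset.
by move=> sub; rewrite -(big_setU1 _ pS) /= leq_sum_subset.
Qed.

Lemma cost_add (c : 'I_n -> nat) S p :
  p.1 \notin items S -> cost c (add S p) = (cost c S + c p.1)%N.
Proof.
move=> pS; rewrite !cost_pairs add_set // big_setU1 1?addnC //.
by apply: contra pS; apply: mem_items.
Qed.

Lemma notin_items_restr S p : p \in sol_set S ->
  p.1 \notin items (restr S (~: [set p])).
Proof.
move=> pS; rewrite items_imset; apply/imsetP => -[q].
by rewrite !inE => /andP[qS /negP qp] /(sol_fst_inj pS qS) pq; apply: qp; rewrite pq.
Qed.

Lemma add_restr S p : p \in sol_set S -> add (restr S (~: [set p])) p = S.
Proof.
move=> pS; apply: val_inj; rewrite /= add_set ?notin_items_restr //=.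
by apply/setP => q; rewrite !inE; case: eqVneq => [->|]; rewrite ?andbT.
Qed.

(** * Counting solutions with few items *)

Lemma card_small_sols : (#|[set S : sol n k | #|items S| <= 2]| <= ((n * k) ^ 2).+1)%N.
Proof.
rewrite -(card_imset _ (@val_inj _ _ (sol n k))).
(* The empty labelling accounts for the successor; a single pair [p] is the image of [(p, p)]. *)
apply: (@leq_trans #|set0 |: [set [set z.1; z.2] | z : ('I_n * 'I_k) * ('I_n * 'I_k)]|).
  apply: subset_leq_card; apply/subsetP => _ /imsetP[S + ->].
  rewrite inE card_items => le2.
  have [S0|/set0Pn[p pS]] := eqVneq (sol_set S) set0; first by rewrite /= S0 setU11.
  rewrite inE; apply/orP; right.
  have [S1|/set0Pn[q]] := eqVneq (sol_set S :\ p) set0.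
    apply/imsetP; exists (p, p) => //=; apply/eqP.
    by rewrite setUid eqEsubset sub1set pS -setD_eq0 S1 eqxx.
  rewrite !inE => /andP[qp qS]; apply/imsetP; exists (p, q) => //=; apply/esym/eqP.
  by rewrite eqEcard subUset !sub1set pS qS cards2 eq_sym qp.
rewrite (leq_trans (leq_card_setU _ _)) // cards1 add1n ltnS.
rewrite (leq_trans (leq_imset_card _ _)) // card_prod card_prod !card_ord.
by rewrite mulnn.
Qed.

Lemma card_triple_sols : (#|[set S : sol n k | #|items S| == 3]| <= (n * k) ^ 3)%N.
Proof.
rewrite -(card_imset _ (@val_inj _ _ (sol n k))).
apply: (@leq_trans #|[set [set z.1.1; z.1.2; z.2] |
    z : ('I_n * 'I_k) * ('I_n * 'I_k) * ('I_n * 'I_k)]|).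
  apply: subset_leq_card; apply/subsetP => _ /imsetP[S + ->].
  rewrite inE card_items => /eqP S3.
  have /card_gt2P[p [q [r [[pS qS rS] [pq qr rp]]]]] : (2 < #|sol_set S|)%N by rewrite S3.
  apply/imsetP; exists (p, q, r) => //=; apply/esym/eqP.
  by rewrite eqEcard !subUset !sub1set pS qS rS S3 (cards3 pq qr rp).
rewrite (leq_trans (leq_imset_card _ _)) // !card_prod !card_ord.
by rewrite (expnS _ 2) -mulnn mulnC.
Qed.

End Labellings.

(** * Runs of oracle programs *)

Section Runs.
Variables (R : realType) (n k : nat) (f : sol n k -> R).

Lemma exec_bind (T T' : Type) (p : prog R n k T) (g : T -> prog R n k T') x m :
  exec f (bind p g) x m ->
  exists y m1 m2, [/\ exec f p y m1, exec f (g y) x m2 & m = (m1 + m2)%N].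
Proof.
elim: p m => [y|q cont IH|X P cont IH] m /=.
- by move=> ex; exists y, 0%N, m.
- case=> m' -> /IH[y [m1 [m2 [e1 e2 ->]]]].
  by exists y, m1.+1, m2; split=> //; exists m1.
- case=> z Pz /IH[y [m1 [m2 [e1 e2 ->]]]].
  by exists y, m1, m2; split=> //; exists z.
Qed.

Lemma never_stuck_bind (T T' : Type) (p : prog R n k T)
    (g : T -> prog R n k T') :
  never_stuck f p -> (forall y m, exec f p y m -> never_stuck f (g y)) ->
  never_stuck f (bind p g).
Proof.
elim: p => [y|q cont IH|X P cont IH] /=.
- by move=> _ /(_ y 0%N); apply.
- by move=> nsp nsg; apply: IH => // y m ey; apply: (nsg y m.+1); exists m.
- case=> exP nsp nsg; split=> // z Pz; apply: IH; first exact: nsp.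
  by move=> y m ey; apply: (nsg y m); exists z.
Qed.

(** Restricts to routines with a determined value and a query count [d] independent of the argument,
    so that tabulating [s] costs exactly [d * size s]. *)
Definition computes (X : Type) (g : X -> prog R n k R) (h : X -> R) (d : nat) :=
  forall x, never_stuck f (g x) /\
    forall v m, exec f (g x) v m -> v = h x /\ m = d.

Lemma eval_computes : computes (@eval R n k) f 1.
Proof. by move=> S; split=> // v m /= [_ -> [-> ->]]. Qed.

Lemma density_computes (c : 'I_n -> nat) (S : sol n k) :
  computes (density R c S) (fun p => (f (add S p) - f S) / (c p.1)%:R) 2.
Proof. by move=> p; split=> // v m /= [_ -> [_ -> [-> ->]]]. Qed.

(** * Selecting an arbitrary maximizer *)

Section Argmax.
Variables (X : eqType) (g : X -> prog R n k R) (h : X -> R) (d : nat).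
Hypothesis gh : computes g h d.

Lemma exec_tabulate (s : seq X) tbl m : exec f (tabulate g s) tbl m ->
  tbl = [seq (x, h x) | x <- s] /\ m = (d * size s)%N.
Proof.
elim: s tbl m => [|x s IH] tbl m /=; first by case=> -> ->; rewrite muln0.
move=> ex; case: (exec_bind ex) => {ex} v [m1 [m2 [/(proj2 (gh x))[-> ->] + ->]]].
move=> ex; case: (exec_bind ex) => {ex} tbl' [m3 [m4 [/IH[-> ->] [-> ->] ->]]].
by rewrite addn0 mulnS.
Qed.

Lemma never_stuck_tabulate (s : seq X) : never_stuck f (tabulate g s).
Proof.
elim: s => //= x s IH; apply: never_stuck_bind; first exact: (proj1 (gh x)).
by move=> v m _; apply: never_stuck_bind.
Qed.

Lemma exec_argmax (s : seq X) x m : exec f (argmax g s) x m ->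
  [/\ x \in s, {in s, forall y, h y <= h x} & m = (d * size s)%N].
Proof.
move=> ex; case: (exec_bind ex) => {ex} tbl [m1 [m2 [/exec_tabulate[-> ->] + ->]]] /=.
case=> -[y v] /andP[/mapP[z zs [-> ->]] /allP maxz] [-> ->].
rewrite addn0; split=> // y' y's.
by have /= := maxz (y', h y'); apply; apply/mapP; exists y'.
Qed.

Lemma never_stuck_argmax (s : seq X) : s != [::] -> never_stuck f (argmax g s).
Proof.
move=> s_neq0; apply: never_stuck_bind; first exact: never_stuck_tabulate.
move=> tbl m /exec_tabulate[-> _] /=; split=> //.
suff [x xs maxx] : exists2 x, x \in s & {in s, forall y, h y <= h x}.
  exists (x, h x); apply/andP; split; first by apply/mapP; exists x.
  by apply/allP => _ /mapP[y ys ->]; apply: maxx.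
elim: s s_neq0 => // x [|y s] IH _.
  by exists x; rewrite ?mem_head // => z; rewrite inE => /eqP->.
have [//|z zs maxz] := IH.
have [xz|/ltW zx] := leP (h x) (h z).
  exists z; first by rewrite inE zs orbT.
  by move=> w; rewrite inE => /predU1P[->//|/maxz].
exists x; first exact: mem_head.
by move=> w; rewrite inE => /predU1P[->//|/maxz/le_trans]; apply.
Qed.

End Argmax.
End Runs.

(** * Marginal gains *)

Section Gains.
Variables (R : realType) (n k : nat) (f : sol n k -> R).
Hypotheses (mono : monotone f) (subm : ksubmodular f).
Implicit Types (I S T O : sol n k) (p q : 'I_n * 'I_k).

(** If the union is itself a labelling, no item receives two labels and the join discards
    nothing. *)
Lemma sqcup_compatible S T U :
  sol_set U = sol_set S :|: sol_set T -> sqcup S T = U.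
Proof.
move=> eU; apply: val_inj; rewrite /= eU; apply/setP => -[a i].
rewrite !in_set /=; apply/andP/orP => [[_]|aiST]; first by move/orP.
split; last exact/orP.
apply/bigcupP => -[j ji]; rewrite !in_set => /orP ajST.
case/eqP: ji; apply: (is_solP _ (solP U) a); rewrite eU in_set; exact/orP.
Qed.

Lemma sqcap_setI S T : sol_set (sqcap S T) = sol_set S :&: sol_set T.
Proof. by apply/setP => -[a i]; rewrite !inE. Qed.

(** Diminishing returns: this is $k$-submodularity for [add S p] and [T], whose join is [add T p]
    and whose meet is [S]. *)
Lemma gain_antitone S T p : sol_set S \subset sol_set T -> p.1 \notin items T ->
  f (add T p) - f T <= f (add S p) - f S.
Proof.
move=> sST pT; have pS : p.1 \notin items S.
  by apply: contra pT; apply/subsetP/items_subset.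
have eU : sqcup (add S p) T = add T p.
  by apply: sqcup_compatible; rewrite !add_set // -setUA (setUidPr sST).
have eI : sqcap (add S p) T = S.
  apply/val_inj/(etrans (sqcap_setI _ _)); rewrite add_set // setIUl.
  rewrite (setIidPl sST) (_ : [set p] :&: _ = set0) ?set0U //.
  apply/setP => q; rewrite !inE; case: eqVneq => //= ->.
  by apply: contraNF pT; apply: mem_items.
by have := subm (add S p) T; rewrite eU eI; lra.
Qed.

(** Strip the pairs of [O] outside [S] one at a time; by [gain_antitone] each removal loses at most
    the gain of that pair over [S]. *)
Lemma gain_le_sum S O : sol_set S \subset sol_set O ->
  f O - f S <= \sum_(p in sol_set O :\: sol_set S) (f (add S p) - f S).
Proof.
have [m] := ubnP #|sol_set O :\: sol_set S|; elim: m => // m IH in O * => leOm sSO.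
have [OS0|/set0Pn[p pOS]] := eqVneq (sol_set O :\: sol_set S) set0.
  rewrite OS0 big_set0 (_ : O = S) ?subrr //; apply: val_inj; apply/eqP.
  by rewrite eqEsubset sSO -setD_eq0 OS0 eqxx.
have /setDP[pO pS] := pOS; set O1 := restr O (~: [set p]).
have sSO1 : sol_set S \subset sol_set O1.
  by rewrite subsetI sSO subsetC sub1set inE.
have eO1 : sol_set O1 :\: sol_set S = (sol_set O :\: sol_set S) :\ p.
  by apply/setP => q; rewrite !inE andbA andbC.
rewrite (big_setD1 p pOS) /= -eO1.
have le1 : f O - f O1 <= f (add S p) - f S.
  by rewrite -{1}(add_restr pO) gain_antitone // notin_items_restr.
have : f O1 - f S <= \sum_(q in sol_set O1 :\: sol_set S) (f (add S q) - f S).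
  apply: IH => //; rewrite eO1; rewrite (cardsD1 p) pOS in leOm; exact: leOm.
lra.
Qed.

(* [O] is [T0] with the items of [S] relabelled as in [S]; since [S] takes the
   best label at each step, relabelling costs at most what [S] gained. *)
Definition tracked I T0 S := exists O,
  [/\ sol_set S \subset sol_set O, sol_set O :\: sol_set S \subset sol_set T0
    & f T0 - f O <= f S - f I].

Lemma tracked_init I T0 : sol_set I \subset sol_set T0 -> tracked I T0 I.
Proof. by move=> sIT; exists T0; rewrite sIT subsetDl !subrr. Qed.

(** The new witness is [O] with the item of [p] dropped and then restored with the label of [p]. The
    loss is at most the gain of [p] over [S], which is exactly the growth of the allowance
    [f S - f I]. *)
Lemma tracked_add I T0 S p : p.1 \notin items S ->
  (forall j, f (add S (p.1, j)) <= f (add S p)) ->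
  tracked I T0 S -> tracked I T0 (add S p).
Proof.
move=> pS best [O [sSO sOT fO]].
set O1 := restr O [set q | q.1 != p.1].
have pO1 : p.1 \notin items O1.
  by rewrite items_imset; apply/imsetP => -[q]; rewrite !inE => /andP[_ /eqP + /esym].
have sSO1 : sol_set S \subset sol_set O1.
  apply/subsetP => q qS; rewrite !inE (subsetP sSO) //=.
  by apply: contraNneq pS => <-; apply: mem_items.
exists (add O1 p); rewrite !add_set //; split.
- exact: setUS.
- apply/subsetP => q; rewrite !inE negb_or -andbA.
  case/and3P => /negPf-> /= qS /andP[qO _].
  by rewrite (subsetP sOT) // inE qS.
(* If [O] gives the item a label [j], dropping it loses at most the gain of [j] over [S], and no
   label gains more than that of [p]. Otherwise [O1] is [O], and monotonicity suffices. *)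
have leO1 : f O - f O1 <= f (add S p) - f S.
  have [/[!inE]/existsP[j pjO]|pO] := boolP (p.1 \in items O).
    have eO1 : O1 = restr O (~: [set (p.1, j)]).
      apply: val_inj; apply/setP => q; rewrite !inE /=.
      case qO: (q \in _) => //=; congr (~~ _); apply/eqP/eqP => [|->//].
      exact: (sol_fst_inj qO pjO).
    have := gain_antitone (p := (p.1, j)) sSO1 pO1.
    rewrite {1}eO1 add_restr //; have := best j; lra.
  rewrite (_ : O1 = O); last first.
    apply: val_inj; apply/setP => q; rewrite !inE /=; case qO: (q \in _) => //=.
    by apply: contraNneq pO => <-; apply: mem_items.
  have := mono (subset_add S p); lra.
have := mono (subset_add O1 p); lra.
Qed.

(** Pass from [T0] to the witness [O] at a loss of at most [f S - f I], then from [O] to [S] by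
    summing the gains of the missing pairs, each at most its cost times [theta]. *)
Lemma tracked_gain_le (c : 'I_n -> nat) I T0 S (theta : R) : 0 <= theta ->
  sol_set I \subset sol_set S -> sol_set I \subset sol_set T0 ->
  (forall q, q \in sol_set T0 -> q.1 \notin items S ->
     f (add S q) - f S <= (c q.1)%:R * theta) ->
  tracked I T0 S ->
  f T0 - f I <= 2 * (f S - f I) + ((cost c T0)%:R - (cost c I)%:R) * theta.
Proof.
move=> theta0 sIS sIT dens [O [sSO sOT fO]].
suff : f O - f S <= ((cost c T0)%:R - (cost c I)%:R) * theta by lra.
apply: le_trans (gain_le_sum sSO) _.
apply: (@le_trans _ _ (\sum_(p in sol_set O :\: sol_set S) (c p.1)%:R * theta)).
  apply: ler_sum => q qOS; apply: dens; first exact: (subsetP sOT).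
  move: qOS; rewrite inE => /andP[qS qO]; apply: contra qS.
  rewrite items_imset => /imsetP[r rS qr].
  by rewrite (sol_fst_inj qO (subsetP sSO _ rS) qr).
rewrite -mulr_suml ler_wpM2r // -natr_sum -natrB ?cost_subset // ler_nat.
(* The pairs of [O] outside [S] lie in [T0] and, as [S] contains [I], avoid [I]. *)
rewrite !cost_pairs (big_setID (sol_set I) (A := sol_set T0)) /= (setIidPr sIT) addKn.
apply: leq_sum_subset; apply/subsetP => q qOS; rewrite inE (subsetP sOT) // andbT.
by apply: contraTN qOS => /(subsetP sIS) qS; rewrite inE qS.
Qed.

End Gains.

(** The bound on [D] gives [D / 2 - x <= beta * theta], so a gain of [ca * theta] multiplies a
    positive gap [D / 2 - x] by at most [1 - ca / beta <= expR (- (ca / beta))]. A gap that is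
    already nonpositive stays so. *)
Lemma decay_step (R : realType) (D x beta gamma ca theta : R) :
  0 <= D -> 0 < beta -> 0 <= theta -> 0 <= ca ->
  D <= 2 * x + beta * theta ->
  D / 2 - x <= D / 2 * expR (- (gamma / beta)) ->
  D / 2 - (x + ca * theta) <= D / 2 * expR (- ((gamma + ca) / beta)).
Proof.
move=> D0 b0 t0 ca0 Dle IH.
rewrite (mulrDl gamma) [X in expR X]opprD expRD mulrA.
have e0 := expR_gt0 (- (ca / beta)); have e1 := expR_ge1Dx (- (ca / beta)).
have [xD|Dx] := leP (D / 2) x.
  have : 0 <= D / 2 * expR (- (gamma / beta)) * expR (- (ca / beta)).
    by rewrite !mulr_ge0 ?expR_ge0 //; lra.
  have : 0 <= ca * theta by rewrite mulr_ge0.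
  lra.
apply: (@le_trans _ _ ((D / 2 - x) * expR (- (ca / beta)))); last first.
  by rewrite ler_pM2r.
apply: (@le_trans _ _ ((D / 2 - x) * (1 - ca / beta))); last first.
  by rewrite ler_pM2l // subr_gt0.
have le1 : (D / 2 - x) / beta <= theta.
  by rewrite ler_pdivrMr // mulrC; move: (mulr_ge0 (ltW b0) t0); lra.
by have := ler_wpM2l ca0 le1; rewrite mulrBr mulr1 (mulrCA _ ca); lra.
Qed.

(** * Greedy runs *)

Section Greedy.
Variables (R : realType) (n k : nat) (f : sol n k -> R).
Variables (c : 'I_n -> nat) (B : R).
Implicit Types (I S T F J : sol n k) (p q : 'I_n * 'I_k) (W : {set 'I_n}).

(** There are at most [n * k] candidate pairs, and each density takes two evaluations. *)
Lemma exec_greedyS t S W F m : W != set0 ->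
  exec f (greedy c B t.+1 S W) F m ->
  exists p m', [/\ p.1 \in W,
    forall q, q.1 \in W -> (f (add S q) - f S) / (c q.1)%:R
                           <= (f (add S p) - f S) / (c p.1)%:R,
    exec f (greedy c B t
      (if (cost c S + c p.1)%N%:R <= B then add S p else S) (W :\ p.1)) F m'
    & (m <= 2 * (n * k) + m')%N].
Proof.
move=> W0 /=; rewrite (negPf W0) => ex.
case: (exec_bind ex) => {ex} p [m1 [m2 [ex1 ex2 ->]]].
have [+ + ->] := exec_argmax (density_computes f c S) ex1.
rewrite mem_enum inE => pW best; exists p, m2; split=> //.
  by move=> q qW; apply: best; rewrite mem_enum inE.
rewrite leq_add2r leq_mul2l /= -cardE (leq_trans (max_card _)) //.
by rewrite card_prod !card_ord.
Qed.

Lemma exec_greedy_subset t S W F m :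
  exec f (greedy c B t S W) F m -> sol_set S \subset sol_set F.
Proof.
elim: t => [|t IH] in S W m *; first by case=> ->.
have [->|W0] := eqVneq W set0; first by rewrite /= eqxx => -[->].
case/(exec_greedyS W0) => p [m' [_ _ /IH sSF _]]; apply: subset_trans sSF.
by case: ifP => // _; apply: subset_add.
Qed.

Lemma exec_greedy_feasible t S W F m : feasible c B S ->
  exec f (greedy c B t S W) F m -> feasible c B F.
Proof.
elim: t => [|t IH] in S W m * => feasS; first by case=> ->.
have [->|W0] := eqVneq W set0; first by rewrite /= eqxx => -[->].
case/(exec_greedyS W0) => p [m' [_ _ /IH + _]]; apply.
by case: ifP => // leB; apply: le_trans leB; rewrite ler_nat cost_add_le.
Qed.

Lemma exec_greedy_queries t S W F m :
  exec f (greedy c B t S W) F m -> (m <= t * (2 * (n * k)))%N.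
Proof.
elim: t => [|t IH] in S W m *; first by case=> _ ->.
have [->|W0] := eqVneq W set0; first by rewrite /= eqxx => -[_ ->].
case/(exec_greedyS W0) => p [m' [_ _ /IH lem' lem]].
by rewrite (leq_trans lem) // mulSn leq_add2l.
Qed.

Lemma never_stuck_greedy t S W : (0 < k)%N -> never_stuck f (greedy c B t S W).
Proof.
move=> k0; elim: t => [//|t IH] in S W *; rewrite /=; case: ifPn => // W0.
apply: never_stuck_bind => [|p m _]; last exact: IH.
apply: never_stuck_argmax (density_computes f c S) _ _.
have /set0Pn[a aW] := W0.
have : (a, Ordinal k0) \in enum [set p : 'I_n * 'I_k | p.1 \in W].
  by rewrite mem_enum inE.
by case: (enum _).
Qed.

(** * Invariant of the greedy phase up to the first rejection of an item of [T] *)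

Definition decayed I T0 S : Prop :=
  0 < (cost c T0)%:R - (cost c I)%:R :> R ->
  (f T0 - f I) / 2 - (f S - f I) <=
  (f T0 - f I) / 2 *
    expR (- (((cost c S)%:R - (cost c I)%:R) / ((cost c T0)%:R - (cost c I)%:R))).

(** [inv_cover] says that no item of [T] has been rejected. Tracking and decay are kept for every
    [T0] between [I] and [T], because the pair to be left out is known only when it is rejected. *)
Record greedy_inv I T S W : Prop := GreedyInv {
  inv_sub : sol_set I \subset sol_set S;
  inv_disj : forall a, a \in W -> a \notin items S;
  inv_cover : forall p, p \in sol_set T -> p.1 \notin items S -> p.1 \in W;
  inv_track : forall T0, sol_set I \subset sol_set T0 ->
    sol_set T0 \subset sol_set T -> tracked f I T0 S;
  inv_decay : forall T0, sol_set I \subset sol_set T0 ->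
    sol_set T0 \subset sol_set T -> decayed I T0 S }.

Hypotheses (mono : monotone f) (subm : ksubmodular f).
Hypothesis c_gt0 : forall a, (0 < c a)%N.

Lemma greedy_inv_init I T : greedy_inv I T I (~: items I).
Proof.
split=> //.
- by move=> a; rewrite in_setC.
- by move=> p _; rewrite in_setC.
- by move=> T0 + _; apply: tracked_init.
- by move=> T0 sIT _ _; rewrite !subrr mul0r oppr0 expR0 mulr1 addr0.
Qed.

(** By [inv_cover] every pair of [T0] on an item outside [S] is still a candidate, so the density of
    [p] can serve as [theta]. *)
Lemma greedy_gain_le I T S W p T0 : greedy_inv I T S W ->
  p.1 \in W ->
  (forall q, q.1 \in W -> (f (add S q) - f S) / (c q.1)%:R
                           <= (f (add S p) - f S) / (c p.1)%:R) ->
  sol_set I \subset sol_set T0 -> sol_set T0 \subset sol_set T ->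
  f T0 - f I <= 2 * (f S - f I)
    + ((cost c T0)%:R - (cost c I)%:R) * ((f (add S p) - f S) / (c p.1)%:R).
Proof.
move=> inv pW best sIT sTT.
apply: (tracked_gain_le subm _ (inv_sub inv) sIT).
- by rewrite divr_ge0 // subr_ge0 mono ?subset_add.
- move=> q qT qS; rewrite mulrC -ler_pdivrMr ?ltr0n //.
  by apply/best/(inv_cover inv) => //; apply: (subsetP sTT).
- exact: inv_track inv _ sIT sTT.
Qed.

Lemma greedy_inv_add I T S W p : greedy_inv I T S W ->
  p.1 \in W ->
  (forall q, q.1 \in W -> (f (add S q) - f S) / (c q.1)%:R
                           <= (f (add S p) - f S) / (c p.1)%:R) ->
  greedy_inv I T (add S p) (W :\ p.1).
Proof.
move=> inv pW best; have pS := inv_disj inv pW.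
split.
- exact: subset_trans (inv_sub inv) (subset_add _ _).
- move=> a /setD1P[ap aW]; apply/negP => /(subsetP (items_add _ _)).
  by rewrite !inE (negPf ap) /= => aS; have := inv_disj inv aW; rewrite inE aS.
- move=> q qT; rewrite items_imset add_set // imsetU1 -items_imset !inE.
  by rewrite negb_or => /andP[-> qS]; apply: (inv_cover inv qT); rewrite inE.
- move=> T0 sIT sTT; apply: tracked_add => //; last exact: inv_track inv _ sIT sTT.
  move=> j; have := best (p.1, j) pW.
  by rewrite ler_pM2r ?invr_gt0 ?ltr0n //= lerD2r.
- move=> T0 sIT sTT beta0.
  have cp0 : 0 < (c p.1)%:R :> R by rewrite ltr0n.
  rewrite cost_add // natrD [(_ + (c p.1)%:R)%R - _]addrAC.
  (* The gain is written as cost times density to match [decay_step]. *)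
  rewrite (_ : f (add S p) - f I =
    f S - f I + (c p.1)%:R * ((f (add S p) - f S) / (c p.1)%:R)); last first.
    by rewrite mulrCA divff ?gt_eqF // mulr1; lra.
  apply: decay_step => //.
  + by rewrite subr_ge0 mono.
  + by rewrite divr_ge0 // subr_ge0 mono ?subset_add.
  + exact: greedy_gain_le inv pW best sIT sTT.
  + exact: inv_decay inv _ sIT sTT beta0.
Qed.

Lemma greedy_inv_reject I T S W a : greedy_inv I T S W -> a \notin items T ->
  greedy_inv I T S (W :\ a).
Proof.
move=> [sIS disj cover track decay] aT; split=> //.
- by move=> b /setD1P[_]; apply: disj.
- move=> q qT qS; rewrite !inE cover // andbT.
  by apply: contraNneq aT => <-; apply: mem_items.
Qed.

Lemma greedy_inv_done I T S : greedy_inv I T S set0 ->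
  sol_set I \subset sol_set T -> f T - f I <= 2 * (f S - f I).
Proof.
move=> inv sIT; rewrite -[leRHS]addr0.
(* Here [theta] is 0: with no candidate left, all items of [T] are in [S] and the density condition
   is vacuous. *)
rewrite -(mulr0 ((cost c T)%:R - (cost c I)%:R)).
apply: (tracked_gain_le subm _ (inv_sub inv) sIT) => //; last exact: inv_track inv _ sIT _.
by move=> q qT /(inv_cover inv qT); rewrite in_set0.
Qed.

(* Until the item of [q] is rejected, the run also competes against [T] without
   [q], and by then it has spent more than the cost of [T] without [q]. *)
Lemma greedy_inv_stop I T S W p q : feasible c B T ->
  sol_set I \subset sol_set T -> greedy_inv I T S W -> p.1 \in W ->
  (forall q, q.1 \in W -> (f (add S q) - f S) / (c q.1)%:R
                           <= (f (add S p) - f S) / (c p.1)%:R) ->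
  B < (cost c S + c p.1)%N%:R -> q \in sol_set T -> q.1 = p.1 ->
  (f (restr T (~: [set q])) - f I) / 2 * (1 - expR (- 1)) <= f S - f I.
Proof.
move=> feasT sIT inv pW best over qT qp; set T0 := restr T _.
have sTT : sol_set T0 \subset sol_set T by apply: subsetIl.
have sIT0 : sol_set I \subset sol_set T0.
  rewrite subsetI sIT subsetC sub1set inE; apply/negP => qI.
  by case/negP: (inv_disj inv pW); rewrite -qp mem_items // (subsetP (inv_sub inv)).
have D0 : 0 <= f T0 - f I by rewrite subr_ge0 mono.
have costT : cost c T = (cost c T0 + c q.1)%N.
  by rewrite -{1}(add_restr qT) cost_add // notin_items_restr.
(* Cancel the cost of the rejected item in [cost c T <= B < cost c S + c p.1]. *)
have costS : (cost c T0 < cost c S)%N.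
  have := le_lt_trans feasT over.
  by rewrite costT qp ltr_nat ltn_add2r.
have costI : (cost c I <= cost c T0)%N by apply: cost_subset.
have e0 : 0 <= (f T0 - f I) / 2 * expR (- 1).
  by rewrite mulr_ge0 ?expR_ge0 //; lra.
have := greedy_gain_le inv pW best sIT0 sTT.
(* If [T0] and [I] have equal cost, [decayed] is void, but [greedy_gain_le] then already gives half
   of [f T0 - f I]. *)
have [beta0|beta0] := eqVneq ((cost c T0)%:R - (cost c I)%:R : R) 0.
  by rewrite beta0 mul0r addr0 (mulrBr _ 1) mulr1; lra.
have {}beta0 : 0 < (cost c T0)%:R - (cost c I)%:R :> R.
  by rewrite lt0r beta0 subr_ge0 ler_nat.
move=> _; have := inv_decay inv sIT0 sTT beta0.
set e := expR _ => decay.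
(* As [S] costs more than [T0], the exponent is at most -1. *)
have : (f T0 - f I) / 2 * e <= (f T0 - f I) / 2 * expR (- 1).
  apply: ler_wpM2l; first lra.
  by rewrite ler_expR lerN2 ler_pdivlMr // mul1r lerD2r ler_nat ltnW.
by rewrite (mulrBr _ 1) mulr1; lra.
Qed.

(** Follow the run until an item of [T] is rejected; later rounds only add pairs, so the value
    reached by then survives in [F]. The bound on the size of [W] ensures that the rounds suffice to
    consider every item. *)
Lemma exec_greedy_bound I T t S W F m : feasible c B T ->
  sol_set I \subset sol_set T ->
  greedy_inv I T S W -> (#|W| <= t)%N -> exec f (greedy c B t S W) F m ->
  f T - f I <= 2 * (f F - f I) \/
  exists2 q, q \in sol_set T &
    (f (restr T (~: [set q])) - f I) / 2 * (1 - expR (- 1)) <= f F - f I.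
Proof.
move=> feasT sIT; elim: t => [|t IH] in S W m *.
  rewrite leqn0 cards_eq0 => inv /eqP W0 [-> _]; left.
  by apply: greedy_inv_done sIT; rewrite -W0.
have [->|W0] := eqVneq W set0.
  by rewrite /= eqxx => inv _ [-> _]; left; apply: greedy_inv_done.
move=> inv leW /(exec_greedyS W0)[p [m' [pW best ex _]]].
have {}leW : (#|W :\ p.1| <= t)%N by rewrite (cardsD1 p.1) pW in leW.
move: ex; case: ifPn => [leB|]; first exact/IH/leW/greedy_inv_add.
rewrite -ltNge => over ex.
have [|pT] := boolP (p.1 \in items T); last first.
  by apply: IH leW ex; apply: greedy_inv_reject.
rewrite items_imset => /imsetP[q qT pq]; right; exists q => //.
apply: le_trans (greedy_inv_stop feasT sIT inv pW best over qT (esym pq)) _.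
by rewrite lerD2r mono // (exec_greedy_subset ex).
Qed.

End Greedy.

(** * The whole algorithm *)

(** Per starting triple, [n] greedy rounds of at most [2 * (n * k)] evaluations are followed by two
    more for the comparison. *)
Lemma exec_improve (R : realType) (n k : nat) (f : sol n k -> R)
    (c : 'I_n -> nat) (B : R) (s : seq (sol n k)) (S F : sol n k) (m : nat) :
  all (feasible c B) s -> feasible c B S -> exec f (improve c B s S) F m ->
  [/\ feasible c B F, f S <= f F,
      forall J, J \in s -> exists G m',
        exec f (greedy c B n J (~: items J)) G m' /\ f G <= f F
    & (m <= size s * (2 * (n * (n * k))).+2)%N].
Proof.
elim: s => [|J s IH] in S m *; first by move=> _ feasS [-> ->].
move=> /= /andP[feasJ feass] feasS ex.
case: (exec_bind ex) => {ex} G [m1 [_ [exG [_ -> [m2 -> ex2]] ->]]].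
have feasG := exec_greedy_feasible feasJ exG.
have leG : f G <= f (if f S < f G then G else S) by case: ltP.
have leS : f S <= f (if f S < f G then G else S) by case: ltP => // /ltW.
have [|feasF leF gr lem2] := IH _ _ feass _ ex2; first by case: ifP.
split=> //; first exact: le_trans leF.
  move=> K; rewrite inE => /predU1P[->|/gr//].
  by exists G, m1; split=> //; apply: le_trans leF.
have := exec_greedy_queries exG; rewrite mulSn; lia.
Qed.

Lemma never_stuck_improve (R : realType) (n k : nat) (f : sol n k -> R)
    (c : 'I_n -> nat) (B : R) (s : seq (sol n k)) (S : sol n k) :
  (0 < k)%N -> never_stuck f (improve c B s S).
Proof.
move=> k0; elim: s => //= J s IH in S *.
by apply: never_stuck_bind => [|G m _] /=; [apply: never_stuck_greedy | apply: IH].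
Qed.

(* Any triple of [T] containing its most valuable pair works. *)
Lemma exists_triple (R : realType) (n k : nat) (f : sol n k -> R) (T : sol n k) :
  nonnegative f -> monotone f -> ksubmodular f -> (2 < #|items T|)%N ->
  exists I : sol n k, [/\ sol_set I \subset sol_set T, #|items I| = 3
    & forall q, q \in sol_set T -> f T - f (restr T (~: [set q])) <= f I].
Proof.
move=> nonneg mono subm; rewrite card_items => T3.
have /card_gt0P[p0 p0T] := ltnW (ltnW T3).
pose v p := f (restr T [set p]).
have [p pT maxp] := arg_maxP v p0T.
have /card_gt1P[q [r [qTp rTp qr]]] : (1 < #|sol_set T :\ p|)%N.
  by move: T3; rewrite (cardsD1 p) (pT : p \in sol_set T).
move: qTp rTp => /setD1P[qp qT] /setD1P[rp rT].
have sub : [set p; q; r] \subset sol_set T by rewrite !subUset !sub1set qT rT !andbT.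
exists (restr T [set p; q; r]); split; first exact: subsetIl.
  by rewrite card_items /= (setIidPr sub) cards3 // eq_sym.
(* By diminishing returns, removing [s] loses at most its gain over the empty labelling, hence at
   most [v s <= v p <= f I]. *)
move=> s sT; have := gain_antitone subm (T := restr T (~: [set s]))
  (S := restr T set0) (p := s).
rewrite add_restr // => /(_ _ (notin_items_restr sT)).
rewrite /= setI0 sub0set => /(_ isT) le1.
have le2 : f (add (restr T set0) s) <= v s.
  apply: mono; rewrite add_set /=; last by rewrite items_imset /= setI0 imset0 inE.
  by rewrite setI0 setU0 subsetI subxx sub1set sT.
have le3 : v p <= f (restr T [set p; q; r]).
  by apply: mono; rewrite /= setIS // -setUA subsetUl.
have := maxp s sT; have := nonneg (restr T set0); rewrite /=; lra.
Qed.

Lemma exec_greedy_triple_bound (R : realType) (n k : nat) (f : sol n k -> R)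
    (c : 'I_n -> nat) (B : R) (T F I : sol n k) m :
  nonnegative f -> monotone f -> ksubmodular f -> (forall a, (0 < c a)%N) ->
  feasible c B T -> sol_set I \subset sol_set T ->
  (forall q, q \in sol_set T -> f T - f (restr T (~: [set q])) <= f I) ->
  exec f (greedy c B n I (~: items I)) F m ->
  (1 / 2 - 1 / (2 * expR 1)) * f T <= f F.
Proof.
move=> nonneg mono subm c_gt0 feasT sIT dropT ex.
have -> : 1 / (2 * expR 1) = expR (- 1) / 2 :> R.
  by rewrite expRN invfM mulrA div1r mulrC.
have e0 := expR_gt0 (- 1 : R); have e1 : expR (- 1) <= 1 :> R.
  by rewrite -[leRHS]expR0 ler_expR oppr_le0 ler01.
have leW : (#|~: items I| <= n)%N by rewrite -[leqRHS](card_ord n) max_card.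
have fI := nonneg I; have fT := nonneg T.
have [le2|[q qT]] := exec_greedy_bound mono subm c_gt0 feasT sIT
  (greedy_inv_init _ _ _ _) leW ex; first by nra.
(* With [f T - f I] as lower bound for the value of [T] without [q], the estimate exceeds the target
   by [f I * expR (- 1)]. *)
by have := dropT q qT; nra.
Qed.

Theorem theorem3p1 (R : realType) :
  exists C : nat,
  forall (n k : nat) (f : sol n k -> R) (c : 'I_n -> nat) (B : R),
    (1 <= k)%N ->
    nonnegative f -> monotone f -> ksubmodular f ->
    (forall a : 'I_n, (0 < c a)%N) ->
    ((exists T : sol n k, feasible c B T) -> never_stuck f (algorithm n k c B))
    /\
    (forall (SA : sol n k) (m : nat), exec f (algorithm n k c B) SA m ->
       [/\ feasible c B SA,
           forall T : sol n k, feasible c B T ->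
             (1 / 2 - 1 / (2 * expR 1)) * f T <= f SA
         & (1 <= n)%N -> (m <= C * (n ^ 5 * k ^ 4))%N]).
Proof.
(* With [N] for $n^5k^4$, the small solutions cost at most [N + N] evaluations and the greedy runs
   at most [2 * N + 2 * N]. *)
exists 6%N => n k f c B k0 nonneg mono subm c_gt0; split.
  case=> T feasT; apply: never_stuck_bind => [|S m _].
    apply: never_stuck_argmax (@eval_computes R n k f) _ _.
    (* The empty labelling is feasible as soon as some labelling is, so the first maximization has a
       candidate. *)
    have : restr T set0 \in
        enum [set S : sol n k | (#|items S| <= 2)%N && feasible c B S].
      rewrite mem_enum inE card_items /= setI0 cards0 /=.
      by apply: le_trans feasT; rewrite ler_nat cost_subset ?subsetIl.
    by case: (enum _).
  split; first by exists (enum [set J : sol n k | (#|items J| == 3)%N && feasible c B J]).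
  by move=> s _; apply: never_stuck_improve.
move=> F m ex; case: (exec_bind ex) => {ex} S [m1 [m2 [ex1 [s perm_s ex2] ->]]].
have [+ maxS ->] := exec_argmax (@eval_computes R n k f) ex1.
rewrite mem_enum inE => /andP[_ feasS].
have feas_s : all (feasible c B) s.
  by apply/allP => J; rewrite -(perm_mem perm_s) mem_enum inE => /andP[].
have [feasF leSF gr lem2] := exec_improve feas_s feasS ex2.
split=> // [T feasT|n0].
  (* A small [T] competes in the initial enumeration, and the ratio is at most 1; a larger one
     contains a triple from which a greedy run was started. *)
  have [T2|T3] := leqP #|items T| 2.
    have leT : f T <= f S by apply: maxS; rewrite mem_enum inE T2.
    have : (1 / 2 - 1 / (2 * expR 1)) <= 1 :> R.
      have : 0 <= 1 / (2 * expR 1) :> R by rewrite divr_ge0 // mulr_ge0 ?expR_ge0.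
      lra.
    have := nonneg T; nra.
  have [I [sIT I3 dropT]] := exists_triple nonneg mono subm T3.
  have feasI : feasible c B I by apply: le_trans feasT; rewrite ler_nat cost_subset.
  have [|G [m' [exG leG]]] := gr I.
    by rewrite -(perm_mem perm_s) mem_enum inE I3 feasI.
  apply: le_trans leG; exact: exec_greedy_triple_bound sIT dropT exG.
have size1 : (size (enum [set S : sol n k | (#|items S| <= 2)%N && feasible c B S])
    <= ((n * k) ^ 2).+1)%N.
  rewrite -cardE; apply: leq_trans (card_small_sols n k).
  by apply/subset_leq_card/subsetP => J; rewrite !inE => /andP[].
have size2 : (size s <= (n * k) ^ 3)%N.
  rewrite -(perm_size perm_s) -cardE; apply: leq_trans (card_triple_sols n k).
  by apply/subset_leq_card/subsetP => J; rewrite !inE => /andP[].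
set N := (n ^ 5 * k ^ 4)%N.
have pw a b : (a <= 5 -> b <= 4 -> n ^ a * k ^ b <= N)%N.
  by move=> a5 b4; rewrite leq_mul // leq_pexp2l.
have lem3 : (size s * (2 * (n * (n * k))).+2 <= 2 * N + 2 * (n ^ 3 * k ^ 3))%N.
  apply: (@leq_trans ((n * k) ^ 3 * (2 * (n * (n * k))).+2)%N).
    by rewrite leq_mul2r size2 orbT.
  by rewrite /N expnMn; apply: eq_leq; ring.
have m2N := leq_trans lem2 lem3; rewrite expnMn in size1.
have := (pw 0%N 0%N isT isT, pw 2 2 isT isT, pw 3 3 isT isT).
rewrite !expn0 !mul1n => -[[N0 N2] N3]; apply: leq_trans (leq_add size1 m2N) _.
move: N0 N2 N3; clear; lia.
Qed.
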